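(* For $\lambda\in[0,1]$, let $F_\lambda(\rho):=R(\langle\Psi,\rho\rangle)+\lambda\langle g,\rho\rangle$, so that $F_1\equiv F$. For an inverse temperature $\beta>0$, let $\rho^\star$ be the stationary solution of $$\partial_t\rho_t=-\nabla\cdot(\rho_t v(\rho_t)),\qquad v(\rho)(\theta,r):=\begin{pmatrix} r\\ -\nabla F'([\rho]^\theta)(\theta)-\gamma r-\gamma\beta^{-1}\nabla_r\log\rho(\theta,r)\end{pmatrix},$$ and let $[\rho^\star]^\theta$ be its $\theta$-marginal. Then there exists a constant $C$ that depends on $F$ and $d$ (and not on $\beta$) such that for all $\beta\ge1$, $$F_{1-1/\beta}([\rho^\star]^\theta)\le\inf_{\rho\in\mathcal{P}(\Theta)}F_1(\rho)+\frac{C+d\log\beta}{\beta}.$$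
   Context: $\Theta=\mathbb{R}^d$, $\mathcal{T}\Theta=\mathbb{R}^d\times\mathbb{R}^d$ with points $(\theta,r)$. $\mathcal{P}(\Theta)$, $\mathcal{P}(\mathcal{T}\Theta)$ are the sets of probability density functions on these spaces; for $\rho\in\mathcal{P}(\mathcal{T}\Theta)$, $[\rho]^\theta(\theta)=\int\rho(\theta,r)\,\mathrm{d}r$. For scalar functions $\langle f,h\rangle$ is the Lebesgue integral of the product $fh$. $\nabla\cdot$ is in $(\theta,r)$, $\nabla_r$ is the gradient in $r$. $\gamma>0$ is a constant. $\mathcal{F}$ is a Hilbert space with inner product $\langle\cdot,\cdot\rangle_{\mathcal F}$, $R:\mathcal{F}\to\mathbb{R}_+$, $\Psi:\Theta\to\mathcal{F}$, $g:\Theta\to\mathbb{R}_+$. Put $\langle\Psi,\rho\rangle=\int_\Theta\Psi(\theta)\rho(\theta)\,\mathrm{d}\theta\in\mathcal F$, $F_0(\rho)=R(\langle\Psi,\rho\rangle)$, $F(\rho)=F_0(\rho)+\langle g,\rho\rangle$. The Fréchet differentials are identified with functions on $\Theta$: $F_0'(\rho)(\theta)=\langle R'(\langle\Psi,\rho\rangle),\Psi(\theta)\rangle_{\mathcal F}$, $F'(\rho)=F_0'(\rho)+g$; $\nabla F'(\rho)$ is the gradient in $\theta$. Standing assumptions: (A1) $R$ is convex and Fréchet differentiable. (A2) $\Psi$ is Fréchet differentiable. (A3) $\nabla F'(\rho)\in L^\infty(\Theta)$ for all $\rho\in\mathcal{P}(\Theta)$. (A4) $\{F_0'(\rho):\rho\in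 L^1(\Theta),\|\rho\|_1\le1\}$ is uniformly equicontinuous and uniformly bounded, and $g$ is differentiable and confining, i.e. $\lim_{|\theta|\to\infty}g(\theta)=\infty$ and $\exp(-\beta g)$ is integrable for all $\beta>0$. (A5), imposed on initial conditions: the initial measure is absolutely continuous with density $\rho_0$ satisfying $\langle g(\theta)+|r|^2/2,\rho_0\rangle<\infty$, $\langle\log^+\rho_0,\rho_0\rangle<\infty$ (with $\log^+\rho=\max\{\log\rho,0\}$) and $\int|\nabla F_0'([\rho_0]^\theta)(\theta)|^2\,\mathrm{d}\theta<\infty$. Under these assumptions the equation, equivalently $\partial_t\rho_t=-\nabla\cdot\big[\rho_t\,(r,\,-\nabla F'([\rho_t]^\theta)-\gamma r)\big]+\gamma\beta^{-1}\Delta_r\rho_t$, is known to have a unique solution, continuous in $t\in[0,\infty)$ with values in probability measures on $\mathcal{T}\Theta$. $\rho^\star\in\mathcal{P}(\mathcal{T}\Theta)$ is a stationary solution if the solution $(\rho_t)_{t\ge0}$ with initial condition $\rho_0\equiv\rho^\star$ satisfies $\rho_t\equiv\rho^\star$ for all $t\ge0$. For each $\beta>0$ the stationary solution is unique and is $\rho^\star(\theta,r)=Z_1^{-1}\exp(-\frac\beta2|r|^2)\,\eta(\theta)$ with $Z_1=\int\exp(-\frac\beta2|r|^2)\,\mathrm{d}r$, where $\eta=[\rho^\star]^\theta\in\mathcal{P}(\Theta)$ is the unique solution of $\eta=\exp(-\beta F'(\eta))/\int\exp(-\beta F'(\eta)(\theta))\,\mathrm{d}\theta$; it depends on $\bet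a$.
   Formalization: Assumption (A3) is strengthened: the L^∞ bound on ∇F'(ρ) is required to be uniform over ρ ∈ P(Θ), since with a bound depending on ρ no β-independent constant C need exist. *)

(* Defs.v *)
From HB Require Import structures.
From mathcomp Require Import all_boot all_order all_algebra.
From mathcomp Require Import all_classical all_reals all_analysis.
Set Implicit Arguments. Unset Strict Implicit.
Unset Printing Implicit Defensive.
Import Order.TTheory GRing.Theory Num.Theory numFieldNormedType.Exports.
Local Open Scope classical_set_scope.
Local Open Scope ring_scope.

(* MathComp-Analysis; R^d is 'rV[R]_d. *)

Definition rV_display : measure_display. Proof. exact. Qed.

(* The sigma-algebra generated by the coordinates, i.e. the Borel one. *)
Section rV_measurable.
Context {R : realType} {n : nat}.

Let coor (i : 'I_n) (v : 'rV[R]_n) : measurableTypeR R := v ord0 i.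

HB.instance Definition _ := @isMeasurable.Build rV_display 'rV[R]_n
  (g_sigma_preimage coor)
  (@sigma_algebra0 _ _ _) (@sigma_algebraC _ _) (@sigma_algebra_bigcup _ _ _).

Lemma measurable_coord_rV (i : 'I_n) :
  measurable_fun setT (fun v : 'rV[R]_n => v ord0 i : measurableTypeR R).
Proof.
move=> _ Y mY; rewrite setTI; apply: sub_sigma_algebra => /=.
rewrite -bigcup_seq/=; exists i => /=; first by rewrite mem_index_enum.
by exists Y => //; rewrite setTI.
Qed.

Lemma measurable_fun_rV d (T : measurableType d) (f : T -> 'rV[R]_n) :
  (forall i, measurable_fun setT (fun x => f x ord0 i : measurableTypeR R)) ->
  measurable_fun setT f.
Proof.
move=> mf _ A mA; rewrite setTI; move: A mA.
suff : g_sigma_preimage (fun i => coor i \o f) `<=` measurable.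
  by rewrite g_sigma_preimage_comp => S A mA; apply: S; exists A => //;
     rewrite setTI.
apply: smallest_sub; first exact: sigma_algebra_measurable.
rewrite -bigcup_seq; apply: bigcup_sub => i _ _ [B mB <-]; exact: mf.
Qed.

End rV_measurable.

Section lebesgue_rV.
Context {R : realType}.

Definition cons_rV n (p : measurableTypeR R * 'rV[R]_n) : 'rV[R]_n.+1 :=
  \row_i oapp (p.2 ord0) p.1 (unlift ord0 i).

Definition uncons_rV n (v : 'rV[R]_n.+1) : measurableTypeR R * 'rV[R]_n :=
  (v ord0 ord0, \row_j v ord0 (lift ord0 j)).

Lemma cons_rVK n : cancel (@cons_rV n) (@uncons_rV n).
Proof.
case=> x v; congr pair; first by rewrite mxE unlift_none.
by apply/rowP => j; rewrite !mxE liftK.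
Qed.

Lemma measurable_cons_rV n : measurable_fun setT (@cons_rV n).
Proof.
apply: measurable_fun_rV => i; case: (unliftP ord0 i) => [j|] ->.
  rewrite (_ : (fun _ => _) = fun p : measurableTypeR R * 'rV[R]_n => p.2 ord0 j); last first.
    by apply/funext => p; rewrite mxE liftK.
  exact: (measurableT_comp (measurable_coord_rV j) measurable_snd).
rewrite (_ : (fun _ => _) = fst); first exact: measurable_fst.
by apply/funext => p; rewrite mxE unlift_none.
Qed.

Lemma measurable_uncons_rV n : measurable_fun setT (@uncons_rV n).
Proof.
apply/measurable_fun_pair; first exact: measurable_coord_rV.
apply: measurable_fun_rV => j.
rewrite (_ : (fun _ => _) = fun v : 'rV[R]_n.+1 => v ord0 (lift ord0 j)).
  exact: measurable_coord_rV.
by apply/funext => v; rewrite mxE.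
Qed.

Section step.
Variables (n : nat) (m : {sigma_finite_measure set 'rV[R]_n -> \bar R}).

Definition lebesgue_rVS : set 'rV[R]_n.+1 -> \bar R :=
  pushforward (@lebesgue_measure R \x m)%E (@cons_rV n).

Let M : {measure set 'rV[R]_n.+1 -> \bar R} :=
  measure_function_pushforward__canonical__measure_function_Measure
    (@lebesgue_measure R \x m)%E (@measurable_cons_rV n).

HB.instance Definition _ := isMeasure.Build _ _ _ lebesgue_rVS
  (measure0 M) (measure_ge0 M) (@measure_semi_sigma_additive _ _ _ M).

Let sigma_finite_rVS : sigma_finite setT lebesgue_rVS.
Proof.
have /sigma_finiteP[F [FT ndF Foo]] := sigma_finiteT (@lebesgue_measure R).
have /sigma_finiteP[G [GT ndG Goo]] := sigma_finiteT m.
exists (fun k => @uncons_rV n @^-1` (F k `*` G k)).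
  rewrite -preimage_bigcup; apply/esym/seteqP; split=> // v _ /=.
  have [[i _ Fi] [j _ Gj]] : (\bigcup_k F k) (uncons_rV v).1 /\
    (\bigcup_k G k) (uncons_rV v).2 by rewrite -FT -GT.
  exists (maxn i j) => //; split.
  - by apply: (subsetPset _ _ (ndF _ _ (leq_maxl i j))).
  - by apply: (subsetPset _ _ (ndG _ _ (leq_maxr i j))).
move=> k; have [mF Fk] := Foo k; have [mG Gk] := Goo k; split.
  rewrite -[X in measurable X]setTI; apply: measurable_uncons_rV => //.
  exact: measurableX.
rewrite /lebesgue_rVS /pushforward -comp_preimage.
rewrite (_ : _ \o _ = id) ?preimage_id; last exact/funext/cons_rVK.
by rewrite product_measure1E// lte_mul_pinfty// ge0_fin_numE.
Qed.

HB.instance Definition _ :=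
  @Measure_isSigmaFinite.Build _ _ _ lebesgue_rVS sigma_finite_rVS.
End step.

(* Lebesgue measure on R^n; see [lebesgue_rV_box]. *)
Fixpoint lebesgue_rV n : {sigma_finite_measure set 'rV[R]_n -> \bar R} :=
  match n with
  | 0 => \d_(0 : 'rV[R]_0)
  | n'.+1 => lebesgue_rVS (lebesgue_rV n')
  end.

Lemma lebesgue_rV_box n (A : 'I_n -> set (measurableTypeR R)) :
  (forall i, measurable (A i)) ->
  lebesgue_rV n [set v | forall i, A i (v ord0 i)] =
  (\prod_(i < n) lebesgue_measure (A i))%E.
Proof.
elim: n A => [|n IH] A mA.
  by rewrite big_ord0 /= diracE mem_set//; case.
have mB : measurable [set v : 'rV[R]_n | forall i, A (lift ord0 i) (v ord0 i)].
  rewrite (_ : mkset _ = \bigcap_(i in [set: 'I_n])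
      ((fun v : 'rV[R]_n => v ord0 i) @^-1` A (lift ord0 i))).
    apply: fin_bigcap_measurable => // i _.
    by rewrite -[X in measurable X]setTI; apply: measurable_coord_rV.
  by apply/seteqP; split=> v Av i; [move=> _|]; exact: Av.
rewrite big_ord_recl -IH// -product_measure1E//= /lebesgue_rVS /pushforward.
congr (_ _); apply/seteqP; split=> -[x v] /=.
  move=> Av; split; first by have := Av ord0; rewrite mxE unlift_none.
  by move=> i; have := Av (lift ord0 i); rewrite mxE liftK.
by move=> [Ax Av] i; rewrite mxE; case: (unliftP ord0 i) => [j|] ->.
Qed.

End lebesgue_rV.

Section euclidean.
Context {R : realType} {d : nat}.
Implicit Types u v : 'rV[R]_d.

(* The library norm on 'rV[R]_d is the sup norm, hence these. *)
Definition dotp u v : R := \sum_(i < d) u ord0 i * v ord0 i.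
Definition sqnorm v : R := dotp v v.
Definition enorm v : R := Num.sqrt (sqnorm v).

Definition nabla (f : 'rV[R]_d -> R) (th : 'rV[R]_d) : 'rV[R]_d :=
  \row_i 'D_(delta_mx ord0 i) f th.

End euclidean.

Definition density {disp} {T : measurableType disp} {R : realType}
    (mu : {measure set T -> \bar R}) : set (T -> R) :=
  [set rho : T -> R | [/\ measurable_fun setT rho, forall x, 0 <= rho x &
                 (\int[mu]_x (rho x)%:E = 1)%E]].

Definition L1_unit_ball {disp} {T : measurableType disp} {R : realType}
    (mu : {measure set T -> \bar R}) : set (T -> R) :=
  [set rho : T -> R | mu.-integrable setT (fun x => (rho x)%:E) /\
             (\int[mu]_x `|rho x|%:E <= 1)%E].

(* With [ip] satisfying this, the Banach space H is a real Hilbert space. *)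
Definition is_inner_product {R : realType} {H : completeNormedModType R}
    (ip : H -> H -> R) : Prop :=
  [/\ forall x y, ip x y = ip y x,
      forall a x y z, ip (a *: x + y) z = a * ip x z + ip y z &
      forall x, ip x x = `|x| ^+ 2].

Section functional.
Context {R : realType} {d : nat} {H : completeNormedModType R}.
Variables (ip : H -> H -> R) (Rf : H -> R) (dR : H -> H).
Variables (Psi : 'rV[R]_d -> H) (g : 'rV[R]_d -> R).
Implicit Types rho : 'rV[R]_d -> R.

Local Notation mu := (@lebesgue_rV R d).

(* [m] is the H-valued Lebesgue integral of [Psi * rho]: absolute
   integrability, the value being determined by its inner products. *)
Definition is_mean rho (m : H) : Prop :=
  mu.-integrable setT (fun th => (`|Psi th| * rho th)%:E) /\
  forall h, ip h m = (\int[mu]_th (ip h (Psi th) * rho th))%R.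

Definition mean rho : H := xget 0 [set m | is_mean rho m].

Definition F0 rho : R := Rf (mean rho).

(* Possibly +oo, since [g] is unbounded. *)
Definition F (lambda : R) rho : \bar R :=
  ((F0 rho)%:E + lambda%:E * \int[mu]_th (g th * rho th)%:E)%E.

(* [dR m] is the derivative R'(m) seen in H through the inner product. *)
Definition is_gradient : Prop :=
  forall m, differentiable Rf m /\ forall h, 'd Rf m h = ip (dR m) h.

Definition dF0 rho (th : 'rV[R]_d) : R := ip (dR (mean rho)) (Psi th).
Definition dF rho (th : 'rV[R]_d) : R := dF0 rho th + g th.

Definition mean_defined : Prop :=
  forall rho, L1_unit_ball mu rho -> exists m, is_mean rho m.

(* The bound on the L^oo norm is uniform in [rho]: bounds that depend on [rho]
   leave room for Lipschitz constants of [dF rho] that blow up along the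
   stationary densities as the temperature goes to 0. *)
Definition bounded_gradients : Prop :=
  exists L : R, forall rho, density mu rho ->
    \forall th \ae mu, enorm (nabla (dF rho) th) <= L.

Definition uniformly_equicontinuous_dF0 : Prop :=
  forall e : R, 0 < e -> exists2 delta : R, 0 < delta &
    forall rho, L1_unit_ball mu rho -> forall th th' : 'rV[R]_d,
      `|th - th'| < delta -> `|dF0 rho th - dF0 rho th'| < e.

Definition uniformly_bounded_dF0 : Prop :=
  exists B : R, forall rho, L1_unit_ball mu rho ->
    forall th : 'rV[R]_d, `|dF0 rho th| <= B.

Definition confining : Prop :=
  (forall A : R, exists M : R, forall th : 'rV[R]_d, M < `|th| -> A < g th) /\
  (forall beta : R, 0 < beta ->
     mu.-integrable setT (fun th => (expR (- beta * g th))%:E)).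

End functional.

Section kinetic.
Context {R : realType} {d : nat} {H : completeNormedModType R}.
Variables (ip : H -> H -> R) (dR : H -> H).
Variables (Psi : 'rV[R]_d -> H) (g : 'rV[R]_d -> R).

Local Notation mu := (@lebesgue_rV R d).
Local Notation phase := ('rV[R]_d * 'rV[R]_d)%type.

Definition lebesgue_phase : {measure set phase -> \bar R} := (mu \x mu)%E.
Local Notation mu2 := lebesgue_phase.

Implicit Types (rho : phase -> R) (phi : phase -> R) (z : phase).

Definition marginal rho (th : 'rV[R]_d) : R := (\int[mu]_r rho (th, r))%R.

Definition iterated_derivative (s : seq phase) phi : phase -> R :=
  foldr (fun v f => 'D_v f) phi s.

(* C_c^oo: all iterated directional derivatives exist and are continuous. *)
Definition test_function phi : Prop :=
  (forall s, continuous (iterated_derivative s phi) /\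
     forall z v, derivable (iterated_derivative s phi) z v) /\
  (exists2 K : set phase, compact K & forall z, ~ K z -> phi z = 0).

Definition dir_th (i : 'I_d) : phase := (delta_mx ord0 i, 0).
Definition dir_r (i : 'I_d) : phase := (0, delta_mx ord0 i).
Definition nabla_th phi z : 'rV[R]_d := \row_i 'D_(dir_th i) phi z.
Definition nabla_r phi z : 'rV[R]_d := \row_i 'D_(dir_r i) phi z.
Definition laplace_r phi z : R :=
  \sum_(i < d) 'D_(dir_r i) ('D_(dir_r i) phi) z.

(* Formal adjoint of rho |-> - div (rho v(rho)) at the frozen drift: since
   rho * grad_r (log rho) = grad_r rho, the term - gamma / beta * grad_r log rho
   of v(rho) becomes gamma / beta * laplace_r on test functions. *)
Definition generator (gamma beta : R) rho phi z : R :=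
  dotp z.2 (nabla_th phi z) +
  dotp (- nabla (dF ip dR Psi g (marginal rho)) z.1 - gamma *: z.2)
       (nabla_r phi z) +
  gamma / beta * laplace_r phi z.

(* Weak solutions of d/dt rho_t = - div (rho_t v(rho_t)), t >= 0, continuous in
   time for the narrow topology of probability measures. *)
Definition is_solution (gamma beta : R) rho0 (rho : R -> phase -> R) : Prop :=
  [/\ forall t, 0 <= t -> density mu2 (rho t),
      rho 0 = rho0 %[ae mu2],
      forall f : phase -> R, continuous f ->
        (exists M : R, forall z, `|f z| <= M) ->
        {within `[0, +oo[, continuous
          (fun t : R => (\int[mu2]_z (f z * rho t z))%R : R)} &
      forall phi, test_function phi -> forall t : R, 0 <= t ->
        let power s :=
          (\int[mu2]_z (generator gamma beta (rho s) phi z * rho s z))%R : R in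
        lebesgue_measure.-integrable `[0, t] (fun s => (power s)%:E) /\
        (\int[mu2]_z (phi z * rho t z) - \int[mu2]_z (phi z * rho0 z) =
         \int[lebesgue_measure]_(s in `[0, t]) power s)%R].

(* Finite energy, entropy and L^2 norm of the interaction force. [ln] is 0 on
   nonpositive reals, so the maximum below is log^+, including at 0. *)
Definition admissible rho0 : Prop :=
  [/\ (\int[mu2]_z ((g z.1 + sqnorm z.2 / 2) * rho0 z)%:E < +oo)%E,
      (\int[mu2]_z (Num.max (ln (rho0 z)) 0 * rho0 z)%:E < +oo)%E &
      (\int[mu]_th (sqnorm (nabla (dF0 ip dR Psi (marginal rho0)) th))%:E
        < +oo)%E].

(* The solution is unique, so "the solution started at rhos stays at rhos" is
   the existence of one solution from rhos that does; densities are identified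
   almost everywhere. *)
Definition is_stationary (gamma beta : R) rhos : Prop :=
  [/\ density mu2 rhos, admissible rhos &
      exists2 rho, is_solution gamma beta rhos rho &
        forall t, 0 <= t -> rho t = rhos %[ae mu2]].

Definition is_gibbs (beta : R) rhos : Prop :=
  let eta := marginal rhos in
  let weight th := expR (- beta * dF ip dR Psi g eta th) in
  let maxwell r := expR (- (beta / 2) * sqnorm r) in
  (\forall z \ae mu2,
     rhos z = maxwell z.2 / (\int[mu]_r maxwell r)%R * eta z.1) /\
  (\forall th \ae mu, eta th = weight th / (\int[mu]_th' weight th')%R).

(* A known result on the equation, used as a hypothesis and not proved here. *)
Definition stationary_solutions_are_gibbs : Prop :=
  forall gamma beta : R, 0 < gamma -> 0 < beta ->
  forall rhos, is_stationary gamma beta rhos -> is_gibbs beta rhos.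

End kinetic.

(* Main.v *)
Require Import Defs.
From HB Require Import structures.
From mathcomp Require Import all_boot all_order all_algebra.
From mathcomp Require Import all_classical all_reals all_analysis.
From mathcomp Require Import measurable_realfun lra ring.
Set Implicit Arguments.
Unset Strict Implicit.
Unset Printing Implicit Defensive.
Import Order.TTheory GRing.Theory Num.Theory numFieldNormedType.Exports.
Local Open Scope classical_set_scope.
Local Open Scope ring_scope.

(* Write eta for the theta-marginal, w = F_0'(eta), V = w + g and m = inf V.
   Convexity of R gives F_1(nu) >= F_0(eta) + <w, nu - eta> + <g, nu>
   >= F_0(eta) - <w, eta> + m for every density nu, so it suffices to bound
   beta <V - m, eta> - <g, eta> by C + d log beta.  As eta = exp(- beta V) / Z,
   the inequality u <= exp(u - a) - 1 + a for u = beta (V - m) - g, integrated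
   against eta, gives the bound a as soon as
   exp(- a) \int exp(- g) <= Z exp(beta m).  Finally V is Lipschitz with a
   constant L independent of beta, so that V - m is O(1 / beta) on a cube of side
   1 / beta, whence Z exp(beta m) >= exp(- 1 - L d) beta^(- d).

   The bound on nabla V only holds almost everywhere, so the Lipschitz estimate
   rests on V being differentiable everywhere; it is proved on the line first,
   and then by induction on the dimension, slicing null sets by Fubini. *)

(** * Mean value inequality on the line with a null exceptional set *)

(* h is the distribution function of sum_k k * Lebesgue restricted to G_k, for
   open sets G_k containing N of rapidly decreasing measure. *)
Lemma steep_on_null_set (R : realType) (N : set R) (e : R) :
  measurable N -> lebesgue_measure N = 0%E -> 0 < e ->
  exists h : R -> R, [/\ {homo h : x y / x <= y}, forall x, 0 <= h x <= e &
    forall x K, N x -> exists2 del, 0 < del &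
      forall y, x <= y < x + del -> K * (y - x) <= h y - h x].
Proof.
move=> mN N0 e0.
have Gex k : exists U : set R, [/\ open U, N `<=` U &
    (k%:R%:E * lebesgue_measure U <= (e / (2 ^ k.+1)%:R)%:E)%E].
  (* Dividing by [k.+1] instead of [k] keeps the tolerance positive at [k = 0]; the bound with
     weight [k] follows since [k <= k.+1]. *)
  have e1 : 0 < e / (2 ^ k.+1)%:R / k.+1%:R.
    by rewrite !divr_gt0// ltr0n expn_gt0.
  have [|U [oU NU UN]] := lebesgue_regularity_outer mN _ e1.
    by rewrite [X in (X < _)%E](_ : _ = 0%E).
  have mU := open_measurable oU.
  exists U; split => //.
  have UNE : lebesgue_measure U = lebesgue_measure (U `\` N).
    rewrite -[in LHS](setDKU NU); apply: measureU0 => //.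
    exact: measurableD.
  rewrite UNE.
  apply: (@le_trans _ _ (k.+1%:R%:E * lebesgue_measure (U `\` N))%E).
    by apply: lee_wpmul2r => //; rewrite lee_fin ler_nat.
  have k0 : (0 : R) < k.+1%:R by rewrite ltr0n.
  by rewrite -lee_pdivlMl// -EFinM mulrC ltW.
have [G GP] := choice Gex.
have mG k : measurable (G k) by apply: open_measurable; case: (GP k).
have [nu nuE] : exists nu : {measure set (measurableTypeR R) -> \bar R},
    forall A, nu A = (\sum_(k <oo) k%:R%:E * lebesgue_measure (A `&` G k))%E.
  by exists (mseries (fun k => mscale (NngNum (ler0n R k))
    (mrestr (@lebesgue_measure R) (mG k))) 0).
have nuT A : measurable A -> (nu A <= e%:E)%E.
  move=> mA; rewrite nuE; apply: le_trans (epsilon_trick0 xpredT (ltW e0)).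
  apply: lee_nneseries => k _; first by rewrite mule_ge0.
  have [oG NG kG] := GP k; apply: le_trans kG; apply: lee_wpmul2l => //.
  by apply: le_measure; rewrite ?inE;
    [exact: (measurableI _ _ mA (mG k))|exact: mG|exact: subIsetr].
pose J (x : R) : set R := `]-oo, x]%classic.
have mJ x : measurable (J x) by exact: measurable_itv.
have nufin x : nu (J x) \is a fin_num.
  by rewrite ge0_fin_numE//; exact: le_lt_trans (nuT _ (mJ x)) (ltry e).
have nuD x y : x <= y -> nu (J y) = (nu (J x) + nu `]x, y]%classic)%E.
  move=> xy; have -> : J y = J x `|` `]x, y]%classic.
    by rewrite /J -itv_bndbnd_setU// bnd_simp.
  rewrite measureU//; first exact: measurable_itv.
  apply/seteqP; split=> z //=; rewrite /J/= !in_itv/= => -[zx /andP[/lt_geF]].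
  by rewrite zx.
exists (fun x => fine (nu (J x))); split.
- by move=> x y xy; rewrite fine_le// (nuD _ _ xy) leeDl.
- move=> x; apply/andP; split; first by rewrite fine_ge0.
  by rewrite -lee_fin fineK//; apply: nuT (mJ x).
move=> x K Nx.
(* Near [x] everything lies in [G k], where the [k]-th summand of [nu] has density [k >= K]. *)
have [k Kk] : exists k : nat, K <= k%:R.
  by exists (Num.bound `|K|); exact: le_trans (ler_norm K) (ltW (archi_boundP (normr_ge0 K))).
have [oG NG _] := GP k.
have /nbhs_ballP[/= del del0 xG] : nbhs x (G k) by apply: open_nbhs_nbhs; split => //; exact: NG.
exists del => // y /andP[xy yd].
rewrite lerBrDr -lee_fin EFinD !fineK// (nuD _ _ xy) addeC leeD2lE//.
(* The first [k.+1] terms of the series end with index [k], whose term alone is large enough. *)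
rewrite nuE (le_trans _ (nneseries_lim_ge (k.+1) _))//=; last by move=> n _ _; rewrite mule_ge0.
rewrite big_nat_recr//=.
apply: (@le_trans _ _ (k%:R%:E * lebesgue_measure (`]x, y]%classic `&` G k))%E); last first.
  by rewrite leeDr// sume_ge0// => i _; rewrite mule_ge0.
rewrite (_ : `]x, y]%classic `&` G k = `]x, y]%classic); last first.
  apply/seteqP; split => [z []//|z /= zxy]; split => //; apply: xG.
  move: zxy; rewrite in_itv/= /ball/= => /andP[xz zy]; rewrite ltr_norml; apply/andP; split; lra.
rewrite [X in (_ <= _ * X)%E]lebesgue_measure_itv/= lte_fin.
case: ltP => xy'; rewrite -?EFinD -EFinM lee_fin.
  by rewrite ler_wpM2r// subr_ge0.
by rewrite (le_anti (introT andP (conj xy xy'))) subrr !mulr0.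
Qed.

Lemma derivable_increment_le (R : realType) (f : R -> R) (c e : R) :
  derivable f c 1 -> 0 < e ->
  exists2 del, 0 < del &
    forall y, c <= y < c + del -> f y - f c <= ('D_1 f c + e) * (y - c).
Proof.
move=> df e0.
have /cvgrPdist_lt/(_ e e0) : h^-1 *: (f (h *: 1 + c) - f c) @[h --> 0^'] --> 'D_1 f c.
  exact: df.
move=> /nbhs_ballP[/= del del0 Hdel]; exists del => // y /andP[cy yd].
have [->|yc] := eqVneq y c; first by rewrite !subrr mulr0.
have yc0 : 0 < y - c by rewrite subr_gt0 lt_neqAle eq_sym yc.
have := Hdel (y - c); rewrite /ball/= sub0r normrN gtr0_norm// ltrBlDl => /(_ yd).
rewrite gt_eqF// => /(_ isT); rewrite /GRing.scale/= mulr1 subrK.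
rewrite ltr_distlC => /andP[_ /ltW]; rewrite [_ * (f y - _)]mulrC ler_pdivrMr//.
Qed.

(** Nothing bounds the derivative on [N], so the increments of [f] are not recovered by integrating
    it. A continuation argument from [a] to [b] is used instead, with the small increasing function
    [h] paying for the points of [N]. *)
Lemma increment_le_of_ae_derive_le (R : realType) (f : R -> R) (N : set R) (L a b : R) :
  measurable N -> lebesgue_measure N = 0%E -> (forall x, derivable f x 1) ->
  (forall x, ~ N x -> 'D_1 f x <= L) -> a <= b -> f b - f a <= L * (b - a).
Proof.
move=> mN N0 df fL ab; apply/ler_addgt0Pr => e' e'0.
(* Chosen so that [e * (b - a) + e = e']: the first term is the slack in the slope, the second
   bounds the total rise of [h]. *)
pose e := e' / (b - a + 1).
have ba0 : 0 <= b - a by rewrite subr_ge0.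
have e0 : 0 < e by rewrite divr_gt0// ltr_wpDl.
suff : f b - f a <= (L + e) * (b - a) + e.
  move/le_trans; apply; rewrite mulrDl -addrA lerD2l.
  by rewrite -[X in _ + X]mulr1 -mulrDr divfK// gt_eqF// ltr_wpDl.
have [h [hm h01 hN]] := steep_on_null_set mN N0 e0.
pose P x := f x - f a <= (L + e) * (x - a) + (h x - h a).
(* The set of x up to which P holds is closed by continuity of f and monotonicity
   of h, and [step] extends it to the right: off N because of the bound on the
   derivative, on N because h is steeper than f there. *)
suff : P b.
  move/le_trans; apply; rewrite lerD2l.
  by have /andP[_ ?] := h01 b; have /andP[? _] := h01 a; lra.
have step c : exists2 del, 0 < del &
    forall y, c <= y < c + del -> f y - f c <= (L + e) * (y - c) + (h y - h c).
  have [Nc|Nc] := pselect (N c).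
    have [d1 d10 H1] := derivable_increment_le (df c) ltr01.
    (* The requested steepness is the excess over [L + e] of the slope ['D_1 f c + 1], which bounds
       the increments of [f] to the right of [c]. *)
    have [d2 d20 H2] := hN c ('D_1 f c + 1 - (L + e)) Nc.
    exists (Num.min d1 d2) => [|y /andP[cy]]; first by rewrite lt_min d10.
    rewrite -ltrBlDl lt_min !ltrBlDl => /andP[y1 y2].
    have := H1 y; have := H2 y; rewrite cy y1 y2 => /(_ isT) + /(_ isT); nra.
  have [d1 d10 H1] := derivable_increment_le (df c) e0.
  exists d1 => // y cyd; have := H1 y cyd; have := fL _ Nc.
  have /andP[cy _] := cyd; have := hm _ _ cy; nra.
pose S := [set x | a <= x <= b /\ forall y, a <= y <= x -> P y].
have Pa : P a by rewrite /P !subrr mulr0 addr0.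
have Sa : S a.
  by split=> [|y /andP[ay ya]]; rewrite ?lexx// (_ : y = a)//; apply/le_anti/andP.
have Sub : has_ubound S by exists b => x [/andP[]].
have supS : has_sup S by split => //; exists a.
set c := sup S.
have ac : a <= c by apply: ub_le_sup.
have cb : c <= b by apply: ge_sup => [|x [/andP[]]]//; exists a.
have Plt y : a <= y < c -> P y.
  move=> /andP[ay yc]; have [x [_ Sx] yx] := sup_gt (ex_intro _ _ Sa) yc.
  by apply: Sx; rewrite ay ltW.
have Pc : P c.
  have [<-//|nac] := eqVneq a c.
  have {}ac : a < c by rewrite lt_neqAle nac.
  rewrite /P leNgt; apply/negP => nPc.
  have cf : {for c, continuous f} by apply/differentiable_continuous/derivable1_diffP.
  have cphi : {for c, continuous (fun y => f y - (L + e) * (y - a))}.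
    apply: continuousB => //; apply: continuousM; first exact: cst_continuous.
    by apply: continuousB; [exact: id|exact: cst_continuous].
  have phic : f a + h c - h a < f c - (L + e) * (c - a) by lra.
  have : \forall y \near c, f a + h c - h a < f y - (L + e) * (y - a).
    exact: cvgr_gt cphi _ phic.
  move=> /nbhs_ballP[/= del del0 H1].
  pose y := Num.max a (c - del / 2).
  have yc : y < c by rewrite /y gt_max ac/= gtrBl divr_gt0.
  have ay : a <= y by rewrite /y le_max lexx.
  have := H1 y; rewrite /ball/= gtr0_norm ?subr_gt0// ltrBlDr -ltrBlDl.
  rewrite {1}/y lt_max => /(_ _)/wrap[]; first by apply/orP; right; lra.
  have := Plt y; rewrite ay yc => /(_ isT); rewrite /P.
  have := hm _ _ (ltW yc); lra.
have [<-//|ncb] := eqVneq c b.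
have {}cb : c < b by rewrite lt_neqAle ncb.
have [del del0 H1] := step c.
(* A point beyond [c], within reach of [step] and capped at [b]; it belongs to [S], against the
   choice of [c] as supremum. *)
pose z := Num.min b (c + del / 2).
have cz : c < z by rewrite /z lt_min cb/= ltrDl divr_gt0.
have : S z.
  split=> [|y /andP[ay yz]].
    by rewrite (le_trans ac (ltW cz))//= /z ge_min lexx.
  have [yc|cy] := ltP y c; first by apply: Plt; rewrite ay.
  have := H1 y; rewrite cy/= => /(_ _)/wrap[].
    by move: yz; rewrite /z le_min => /andP[_ yz]; lra.
  by move: Pc; rewrite /P; lra.
by move/(ub_le_sup Sub); rewrite leNgt cz.
Qed.

(** * Sections of null sets, and extension of inequalities by continuity *)

(** The measures of the sections are nonnegative and integrate to the product measure of [A], which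
    is zero. *)
Lemma xsection_null d1 d2 (T1 : measurableType d1) (T2 : measurableType d2)
    (R : realType) (m1 : {sigma_finite_measure set T1 -> \bar R})
    (m2 : {sigma_finite_measure set T2 -> \bar R}) (A : set (T1 * T2)) :
  measurable A -> (m1 \x m2)%E A = 0%E ->
  \forall x \ae m1, m2 (xsection A x) = 0%E.
Proof.
move=> mA A0.
have mF : measurable_fun setT (m2 \o xsection A).
  exact: measurable_fun_xsection.
have /(ae_eq_integral_abs m1 measurableT mF).1 : (\int[m1]_x `|(m2 \o xsection A) x| = 0)%E.
  by rewrite -A0; apply: eq_integral => x _ /=; rewrite gee0_abs.
by apply: filterS => x /(_ I).
Qed.

Lemma ysection_null d1 d2 (T1 : measurableType d1) (T2 : measurableType d2)
    (R : realType) (m1 : {sigma_finite_measure set T1 -> \bar R})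
    (m2 : {sigma_finite_measure set T2 -> \bar R}) (A : set (T1 * T2)) :
  measurable A -> (m1 \x m2)%E A = 0%E ->
  \forall y \ae m2, m1 (ysection A y) = 0%E.
Proof.
move=> mA A0.
have mF : measurable_fun setT (m1 \o ysection A).
  exact: measurable_fun_ysection.
have /(ae_eq_integral_abs m2 measurableT mF).1 : (\int[m2]_x `|(m1 \o ysection A) x| = 0)%E.
  (* The product measure integrates over the first factor; uniqueness identifies it with the one
     that integrates over the second. *)
  have -> : 0%E = (m1 \x^ m2)%E A.
    rewrite -A0; apply: product_measure_unique => //= ? ? ? ?.
    by rewrite product_measure2E.
  by apply: eq_integral => x _ /=; rewrite gee0_abs.
by apply: filterS => x /(_ I).
Qed.

Lemma continuous_le_dense (R : realType) (T : topologicalType) (psi : T -> R) (c : R) (x : T) :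
  {for x, continuous psi} ->
  (forall U, nbhs x U -> exists2 y, U y & psi y <= c) -> psi x <= c.
Proof.
move=> cpsi H; rewrite leNgt; apply/negP => cx.
have [|y /=] := H [set y | c < psi y]; first exact: cvgr_gt cpsi _ cx.
by rewrite ltNge => /negP.
Qed.

Lemma rV_ballE (R : realType) n (x : 'rV[R]_n) (e : R) : 0 < e ->
  ball x e = [set v | forall i, (ball (x ord0 i) e : set (measurableTypeR R)) (v ord0 i)].
Proof.
move=> e0; apply/seteqP; split => [v [_ Hv] i|v Hv]; first exact: Hv.
by split=> // i j; rewrite (ord1 i); exact: Hv.
Qed.

Lemma measurable_rV_ball (R : realType) n (x : 'rV[R]_n) (e : R) :
  0 < e -> measurable (ball x e).
Proof.
move=> e0; rewrite (_ : ball x e = \bigcap_(i in [set: 'I_n])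
    ((fun v : 'rV[R]_n => v ord0 i) @^-1` (ball (x ord0 i) e : set (measurableTypeR R)))).
  apply: fin_bigcap_measurable => // i _.
  rewrite -[X in measurable X]setTI; apply: measurable_coord_rV => //.
  exact: measurable_ball.
by rewrite rV_ballE//; apply/seteqP; split=> v Av i; [move=> _|]; exact: Av.
Qed.

Lemma lebesgue_rV_ball_gt0 (R : realType) n (x : 'rV[R]_n) (e : R) :
  0 < e -> (0 < lebesgue_rV n (ball x e))%E.
Proof.
move=> e0; have mB i : measurable (ball (x ord0 i) e : set (measurableTypeR R)).
  exact: measurable_ball.
rewrite (etrans (congr1 (lebesgue_rV n) (rV_ballE x e0)) (lebesgue_rV_box mB)).
elim/big_ind : _ => // [y z y0 z0|i _]; first by rewrite mule_gt0.
by rewrite lebesgue_measure_ball ?ltW// lte_fin mulrn_wgt0.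
Qed.

(** Balls have positive measure, so the complement of a null set is dense, and a closed condition
    that holds there holds everywhere. *)
Lemma ae_lebesgue_rV_le (R : realType) n (psi : 'rV[R]_n -> R) (c : R) :
  continuous psi -> (\forall y \ae lebesgue_rV n, psi y <= c) ->
  forall x, psi x <= c.
Proof.
move=> cpsi [A [mA A0 H]] x; apply: continuous_le_dense (cpsi x) _.
move=> U /nbhs_ballP[e /= e0 xU]; apply: contrapT => nex.
suff : (lebesgue_rV n (ball x e) <= lebesgue_rV n A)%E.
  by rewrite A0 leNgt lebesgue_rV_ball_gt0.
apply: le_measure; rewrite ?inE//; first exact: measurable_rV_ball.
by move=> y xy; apply: H => /= psiy; apply: nex; exists y => //; exact: xU.
Qed.

Lemma ae_lebesgue_measure_le (R : realType) (psi : R -> R) (c : R) :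
  continuous psi -> (\forall y \ae @lebesgue_measure R, psi y <= c) ->
  forall x, psi x <= c.
Proof.
move=> cpsi [A [mA A0 H]] x; apply: continuous_le_dense (cpsi x) _.
move=> U /nbhs_ballP[e /= e0 xU]; apply: contrapT => nex.
suff : (lebesgue_measure (ball x e) <= lebesgue_measure A)%E.
  by rewrite [X in (_ <= X)%E]A0 leNgt lebesgue_measure_ball ?ltW// lte_fin mulrn_wgt0.
apply: le_measure; rewrite ?inE//; first exact: measurable_ball.
by move=> y xy; apply: H => /= psiy; apply: nex; exists y => //; exact: xU.
Qed.

(** * Lipschitz estimates, on the line and then coordinate by coordinate *)

Lemma continuous_cons_rVr (R : realType) n (x0 : R) :
  continuous (fun v : 'rV[R]_n => cons_rV (x0, v)).
Proof.
move=> v U /nbhs_ballP[e /= e0 HU]; apply/nbhs_ballP; exists e => //= w [_ vw].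
apply: HU; split=> // i j; rewrite !mxE; case: (unliftP ord0 j) => [k _|_] /=; first exact: vw.
exact: ballxx.
Qed.

Lemma continuous_cons_rVl (R : realType) n (v : 'rV[R]_n) :
  continuous (fun x0 : R => cons_rV (x0, v)).
Proof.
move=> x0 U /nbhs_ballP[e /= e0 HU]; apply/nbhs_ballP; exists e => //= y0 xy0.
apply: HU; split=> // i j; rewrite !mxE; case: (unliftP ord0 j) => [k _|_] //=.
exact: ballxx.
Qed.

Lemma continuous_dist (R : realType) (T : topologicalType) (f g : T -> R) :
  continuous f -> continuous g -> continuous (fun x => `|f x - g x|).
Proof.
move=> cf cg v.
have cB : {for v, continuous (fun x => f x - g x)} by exact: (continuousB (cf v) (cg v)).
have cN : {for (f v - g v), continuous (fun x : R => `|x|)} by exact: norm_continuous.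
exact: (continuous_comp cB cN).
Qed.

Lemma lipschitz_of_ae_derive_le (R : realType) (f : R -> R) (N : set R) (L : R) :
  measurable N -> lebesgue_measure N = 0%E -> (forall x, derivable f x 1) ->
  (forall x, ~ N x -> `|'D_1 f x| <= L) -> forall a b, `|f a - f b| <= L * `|a - b|.
Proof.
move=> mN N0 df fL.
suff le a b : a <= b -> `|f a - f b| <= L * `|a - b|.
  move=> a b; have [|/ltW] := leP a b; first exact: le.
  by rewrite distrC [`|a - b|]distrC; exact: le.
move=> ab; rewrite distrC [`|a - b|]distrC [`|b - a|]ger0_norm ?subr_ge0//.
rewrite ler_norml lerNl opprB; apply/andP; split; last first.
  by apply: (increment_le_of_ae_derive_le mN N0) ab => // x /fL; apply: le_trans (ler_norm _).
have := @increment_le_of_ae_derive_le R (fun x => - f x) N L a b mN N0.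
rewrite opprK addrC; apply=> // x; first exact: derivableN.
by move=> /fL; rewrite deriveN// -normrN; apply: le_trans (ler_norm _).
Qed.

(** Identifies the difference quotients of a slice of a function with those of the function itself
    along a basis vector. *)
Lemma cons_rV_shiftl (R : realType) n (t h : R) (v : 'rV[R]_n) :
  cons_rV (h *: 1 + t, v) = h *: delta_mx ord0 ord0 + cons_rV (t, v).
Proof.
apply/rowP => j; rewrite !mxE eqxx /=; case: (unliftP ord0 j) => [k|] -> /=.
  by rewrite mulr0 add0r.
by [].
Qed.

Lemma cons_rV_shiftr (R : realType) n (t h : R) (v : 'rV[R]_n) i :
  cons_rV (t, h *: delta_mx ord0 i + v) = h *: delta_mx ord0 (lift ord0 i) + cons_rV (t, v).
Proof.
apply/rowP => j; rewrite !mxE eqxx /=; case: (unliftP ord0 j) => [k|] -> /=.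
  by rewrite !mxE eqxx /= (inj_eq (@lift_inj _ ord0)).
by rewrite mulr0 add0r.
Qed.

Lemma lipschitz_of_ae_gradient_le (R : realType) n (f : 'rV[R]_n -> R) (L : R) :
  continuous f -> (forall x i, derivable f x (delta_mx ord0 i)) ->
  (\forall x \ae lebesgue_rV n, forall i, `|'D_(delta_mx ord0 i) f x| <= L) ->
  forall x y, `|f x - f y| <= L * \sum_(i < n) `|x ord0 i - y ord0 i|.
Proof.
elim: n f => [|n IH] f cf df aeL x y.
  by rewrite big_ord0 mulr0 (thinmx0 x) (thinmx0 y) subrr normr0.
have [A [mA A0 AL]] := aeL.
pose B := @cons_rV R n @^-1` A.
have mB : measurable B.
  by rewrite -[B]setTI; apply: measurable_cons_rV.
(* Holds by conversion: Lebesgue measure in dimension [n.+1] is the pushforward of this product by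
   [cons_rV]. *)
have B0 : (@lebesgue_measure R \x lebesgue_rV n)%E B = 0%E by [].
have AL' p : ~ B p -> forall i, `|'D_(delta_mx ord0 i) f (cons_rV p)| <= L.
  by move=> nBp; apply: contrapT => /(AL (cons_rV p)).
have cr s : continuous (fun v => f (cons_rV (s, v))).
  by move=> v; exact: (continuous_comp (@continuous_cons_rVr R n s v) (cf _)).
have cl v : continuous (fun s => f (cons_rV (s, v))).
  by move=> s; exact: (continuous_comp (@continuous_cons_rVl R n v s) (cf _)).
have Hl s t v : `|f (cons_rV (s, v)) - f (cons_rV (t, v))| <= L * `|s - t|.
  move: v; apply: ae_lebesgue_rV_le.
    exact: continuous_dist (cr s) (cr t).
  have := ysection_null mB B0; apply: filterS => v Bv.
  have Dv u : (fun h => h^-1 *: (f (cons_rV (h *: (1:R) + u, v)) - f (cons_rV (u, v)))) =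
     (fun h => h^-1 *: (f (h *: delta_mx ord0 ord0 + cons_rV (u, v)) - f (cons_rV (u, v)))).
    by apply/funext => h; rewrite cons_rV_shiftl.
  apply: (@lipschitz_of_ae_derive_le R (fun t => f (cons_rV (t, v))) (ysection B v)).
  - exact: (measurable_ysection v mB).
  - exact: Bv.
  - by move=> u; rewrite /derivable Dv; exact: df.
  - move=> u /= Bu; rewrite /derive Dv; apply: AL' => Bp; apply: Bu.
    by rewrite /ysection/= inE.
have Hr s v w : `|f (cons_rV (s, v)) - f (cons_rV (s, w))| <=
    L * \sum_(i < n) `|v ord0 i - w ord0 i|.
  move: s; apply: ae_lebesgue_measure_le.
    exact: continuous_dist (cl v) (cl w).
  have := xsection_null mB B0; apply: filterS => s Bs.
  have Ds u i :
      (fun h => h^-1 *: (f (cons_rV (s, h *: delta_mx ord0 i + u)) - f (cons_rV (s, u)))) =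
      (fun h => h^-1 *: (f (h *: delta_mx ord0 (lift ord0 i) + cons_rV (s, u))
        - f (cons_rV (s, u)))).
    by apply/funext => h; rewrite cons_rV_shiftr.
  apply: (IH (fun u => f (cons_rV (s, u)))).
  - exact: cr.
  - by move=> u i; rewrite /derivable Ds; exact: df.
  - exists (xsection B s); split => //; first exact: measurable_xsection.
    move=> u /= Hu; rewrite /xsection/= inE; apply: contrapT => nB; apply: Hu => i.
    by rewrite /derive Ds; exact: AL'.
have xE (z : 'rV[R]_n.+1) : z = cons_rV (z ord0 ord0, \row_j z ord0 (lift ord0 j)).
  by apply/rowP => j; rewrite !mxE; case: (unliftP ord0 j) => [k|] -> //=; rewrite mxE.
rewrite {1}(xE x) {1}(xE y) big_ord_recl mulrDr.
(* The intermediate point has the first coordinate of [y] and the remaining ones of [x]. *)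
apply: le_trans (ler_distD (f (cons_rV (y ord0 ord0, \row_j x ord0 (lift ord0 j)))) _ _) _.
apply: lerD; first exact: Hl.
apply: le_trans (Hr _ _ _) _; rewrite le_eqVlt; apply/orP; left; apply/eqP.
by congr (_ * _); apply: eq_bigr => i _; rewrite !mxE.
Qed.

(** * Borel measurability of continuous functions *)

(** The sigma-algebra is generated by the coordinates, so an open set is written as a countable
    union of balls with rational centers and radii [k.+1%:R^-1]. *)
Lemma open_rV_measurable (R : realType) n (U : set 'rV[R]_n) :
  open U -> measurable U.
Proof.
move=> oU.
pose B (p : 'rV[rat]_n * nat) : set 'rV[R]_n :=
  ball (\row_i ratr (p.1 ord0 i) : 'rV[R]_n) (p.2.+1%:R^-1).
pose D p := if `[< B p `<=` U >] then B p else set0.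
rewrite (_ : U = \bigcup_p D p).
  apply: countable_bigcupT_measurable => // p; rewrite /D; case: ifP => // _.
  by apply: measurable_rV_ball; rewrite invr_gt0.
apply/seteqP; split=> [x Ux|x [p _]]; last first.
  by rewrite /D; case: asboolP => // pU /pU.
have /nbhs_ballP[e /= e0 xU] : nbhs x U by apply: open_nbhs_nbhs; split.
(* With [t + t < e], a ball of radius [t] that contains [x] stays inside [ball x e]. *)
have [k [t [tE t0 te]]] : exists k t, [/\ t = k.+1%:R^-1 :> R, 0 < t & t + t < e].
  have k2 : 2 / e < (Num.bound (2 / e)).+1%:R.
    by apply: lt_le_trans (archi_boundP _) _; rewrite ?divr_ge0 ?ler_nat// ltW.
  exists (Num.bound (2 / e)), (Num.bound (2 / e)).+1%:R^-1; split => //.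
  by move: k2; rewrite ltr_pdivrMr// mulrC -ltr_pdivrMr// mulrDl mul1r.
have qP i : exists q : rat, ratr q \in `](x ord0 i - t), (x ord0 i + t)[.
  by apply: rat_in_itvoo; lra.
have [q qE] := choice qP.
exists (\row_i q i, k) => //.
have xB : B (\row_i q i, k) x.
  rewrite /B -tE; split => // i j; rewrite (ord1 i) !mxE /ball/= ltr_distlC.
  by have := qE j; rewrite in_itv/= => /andP[? ?]; apply/andP; split; lra.
rewrite /D; case: asboolP => // -[]; apply: subset_trans xU => y By.
apply: le_ball (ltW te) _ _; move: xB By; rewrite /B -tE => xB By.
exact: ball_triangle (ball_sym xB) By.
Qed.

Lemma continuous_rV_measurable (R : realType) n (f : 'rV[R]_n -> R) :
  continuous f -> measurable_fun setT f.
Proof.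
move=> /continuousP cf; apply: (measurability _ (RGenOpens.measurableE R)).
move=> _ [_ [a [b ->] <-]]; rewrite setTI; apply: open_rV_measurable.
exact/cf/interval_open.
Qed.

(** * Tangent inequality and regularity of the first variation *)

(** By convexity the difference quotients at [x] towards [y] are at most [f y - f x] for steps in
    []0, 1]], and so is their limit. *)
Lemma convex_gradient_le (R : realType) (H : normedModType R) (f : H -> R) (x y : H) :
  convex_function [set: convex_lmodType H] f -> differentiable f x ->
  f x + 'd f x (y - x) <= f y.
Proof.
move=> cf df; rewrite -lerBrDl leNgt; apply/negP => lt_d.
have dfv : h^-1 *: (f (h *: (y - x) + x) - f x) @[h --> 0^'] --> 'd f x (y - x).
  by rewrite -deriveE//; exact: diff_derivable.
have : \forall h \near 0^', f y - f x < h^-1 *: (f (h *: (y - x) + x) - f x).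
  exact: cvgr_gt dfv _ lt_d.
move=> /nbhs_ballP[e /= e0 He].
pose t := Num.min 1 (e / 2).
have t0 : 0 < t by rewrite lt_min ltr01 divr_gt0.
have t1 : t <= 1 by rewrite ge_min lexx.
have te : t < e by rewrite gt_min; apply/orP; right; lra.
have := He t; rewrite /ball/= sub0r normrN gtr0_norm// => /(_ te); rewrite gt_eqF// => /(_ isT).
rewrite ltNge => /negP; apply.
rewrite /GRing.scale/= mulrC ler_pdivrMr// lerBlDr.
have -> : t *: (y - x) + x = t *: y + (1 - t) *: x.
  by rewrite scalerBr scalerBl scale1r -addrA; congr (_ + _); rewrite addrC.
apply: le_trans (cf (Itv01 (ltW t0) t1) y x (in_setT _) (in_setT _)) _.
rewrite convRE/= [leLHS](_ : _ = (f y - f x) * t + f x)// /unstable.onem; ring.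
Qed.

(** The pairing with [dR m] is the differential of [Rf] at [m], hence linear and continuous, and
    [dF0] is its composite with [Psi]. *)
Lemma differentiable_dF0 (R : realType) d (H : completeNormedModType R) (ip : H -> H -> R)
    (Rf : H -> R) (dR : H -> H) (Psi : 'rV[R]_d -> H) :
  is_gradient ip Rf dR -> (forall th, differentiable Psi th) ->
  forall rho th, differentiable (dF0 ip dR Psi rho) th.
Proof.
move=> grad dPsi rho th; rewrite /dF0; set m := mean _ _ _.
have [dRf dE] := grad m.
rewrite (_ : (fun _ => _) = 'd Rf m \o Psi); last by apply/funext => x /=; rewrite dE.
by apply: differentiable_comp => //; apply: linear_differentiable; exact: diff_continuous.
Qed.

(** * Marginals of phase space densities *)

Lemma marginal_ge0 (R : realType) d (rho : 'rV[R]_d * 'rV[R]_d -> R) :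
  density lebesgue_phase rho -> forall th, 0 <= marginal rho th.
Proof.
by move=> [_ rho0 _] th; apply: Rintegral_ge0 => r _; exact: rho0.
Qed.

Lemma measurable_marginal (R : realType) d (rho : 'rV[R]_d * 'rV[R]_d -> R) :
  density lebesgue_phase rho -> measurable_fun setT (marginal rho).
Proof.
move=> [mrho rho0 _]; apply: (@measurableT_comp _ _ _ _ _ _ fine).
  exact: fine_measurable.
apply: (@measurable_fun_fubini_tonelli_F _ _ _ _ _ (@lebesgue_rV R d) (EFin \o rho)).
  exact/measurable_EFinP.
by move=> z; rewrite lee_fin.
Qed.

(** Tonelli, as an inequality: [marginal] is a real integral, with value 0 where the integral over
    [r] is infinite. This suffices for membership in the unit ball; mass exactly one comes later
    from the Gibbs form. *)
Lemma integral_marginal_le1 (R : realType) d (rho : 'rV[R]_d * 'rV[R]_d -> R) :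
  density lebesgue_phase rho ->
  (\int[lebesgue_rV d]_th (marginal rho th)%:E <= 1)%E.
Proof.
move=> drho; have [mrho rho0 <-] := drho.
have mE : measurable_fun setT (EFin \o rho) by exact/measurable_EFinP.
have rhoE0 z : (0 <= (EFin \o rho) z)%E by rewrite lee_fin.
rewrite [leRHS](fubini_tonelli1 (EFin \o rho) mE rhoE0).
apply: ge0_le_integral => //.
- by move=> th _; rewrite lee_fin marginal_ge0.
- apply/measurable_EFinP; exact: measurable_marginal.
- exact: (measurable_fun_fubini_tonelli_F (EFin \o rho) mE rhoE0).
- move=> th _; rewrite /marginal /Rintegral /fubini_F/=.
  have : (0 <= \int[lebesgue_rV d]_y (rho (th, y))%:E)%E.
    by apply: integral_ge0 => y _; rewrite lee_fin.
  by case: (integral _ _ _) => [r _| |]//=; rewrite ?leey ?lexx.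
Qed.

Lemma marginal_L1_unit_ball (R : realType) d (rho : 'rV[R]_d * 'rV[R]_d -> R) :
  density lebesgue_phase rho -> L1_unit_ball (lebesgue_rV d) (marginal rho).
Proof.
move=> drho; have le1 : (\int[lebesgue_rV d]_th `|marginal rho th|%:E <= 1)%E.
  under eq_integral do rewrite ger0_norm ?marginal_ge0//.
  exact: integral_marginal_le1.
split=> //; apply/integrableP; split; first by apply/measurable_EFinP; exact: measurable_marginal.
exact: le_lt_trans le1 (ltry 1).
Qed.

(** * Gibbs weights: partition function, moments and free energy *)

Lemma lebesgue_rV_cube (R : realType) n (x : 'rV[R]_n) (e : R) : 0 < e ->
  exists2 A : set 'rV[R]_n, measurable A /\ lebesgue_rV n A = (e ^+ n)%:E &
    forall v, A v -> \sum_(i < n) `|v ord0 i - x ord0 i| <= n%:R * e.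
Proof.
move=> e0.
pose I i : set (measurableTypeR R) := `[x ord0 i, x ord0 i + e]%classic.
have mI i : measurable (I i) by exact: measurable_itv.
pose A := \bigcap_(i in [set: 'I_n]) ((fun v : 'rV[R]_n => v ord0 i) @^-1` I i).
have AE : A = [set v | forall i, I i (v ord0 i)].
  by apply/seteqP; split=> v Av i; [|move=> _]; exact: Av.
exists A; first split.
- apply: fin_bigcap_measurable => // i _.
  by rewrite -[X in measurable X]setTI; apply: measurable_coord_rV.
- rewrite (etrans (congr1 (lebesgue_rV n) AE) (lebesgue_rV_box mI)).
  rewrite (eq_bigr (fun=> e%:E)) => [|i _]; last first.
    rewrite [LHS]lebesgue_measure_itv/= lte_fin ltrDl e0 -EFinD.
    by rewrite addrAC subrr add0r.
  by rewrite prodEFin prodr_const card_ord.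
- move=> v Av; rewrite mulr_natl -[in X in _ <= _ *+ X](card_ord n) -sumr_const.
  apply: ler_sum => i _; have := Av i Logic.I; rewrite /I/= in_itv/= => /andP[? ?].
  by rewrite ger0_norm ?subr_ge0// lerBlDl.
Qed.

(** Only a cube of side [beta^-1] with corner [x] is kept; on it [beta * V] exceeds [beta * V x] by
    at most [L * n%:R]. *)
Lemma partition_function_ge (R : realType) n (V : 'rV[R]_n -> R) (x : 'rV[R]_n) (L beta : R) :
  measurable_fun setT V -> 0 <= L -> 0 < beta ->
  (forall y, `|V y - V x| <= L * \sum_(i < n) `|y ord0 i - x ord0 i|) ->
  ((expR (- beta * V x - L * n%:R) * beta^-1 ^+ n)%:E <=
   \int[lebesgue_rV n]_y (expR (- beta * V y))%:E)%E.
Proof.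
move=> mV L0 b0 VL.
have [|A [mA AE] Ax] := @lebesgue_rV_cube R n x beta^-1; first by rewrite invr_gt0.
have mw : measurable_fun setT (fun y => (expR (- beta * V y))%:E).
  apply/measurable_EFinP; apply: measurableT_comp => //.
  exact: measurable_funM.
apply: (@le_trans _ _ (\int[lebesgue_rV n]_(y in A) (expR (- beta * V y))%:E)%E); last first.
  by apply: ge0_subset_integral => // y _; rewrite lee_fin expR_ge0.
rewrite EFinM -AE -integral_cst//; apply: ge0_le_integral => //.
- by move=> y _; rewrite lee_fin expR_ge0.
- exact: measurable_funS mw.
move=> y /Ax yx; rewrite lee_fin ler_expR.
have := le_trans (ler_norm _) (VL y); move=> Vy.
have : L * \sum_(i < n) `|y ord0 i - x ord0 i| <= L * (n%:R * beta^-1) by exact: ler_wpM2l.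
move=> /(le_trans Vy) /(ler_wpM2l (ltW b0)).
rewrite [X in _ <= X](_ : _ = L * n%:R); last by field; rewrite gt_eqF.
by rewrite !mulNr mulrBr; lra.
Qed.

(** As [w] is bounded, [weight] is dominated by a multiple of [expR (- beta * g x)]. For the moment
    of [g], half of the exponent absorbs the factor [g] and the other half remains integrable. *)
Lemma integrable_gibbs d (T : measurableType d) (R : realType)
    (mu : {measure set T -> \bar R}) (w g : T -> R) (B beta : R) :
  measurable_fun setT w -> measurable_fun setT g ->
  (forall x, `|w x| <= B) -> (forall x, 0 <= g x) ->
  (forall b, 0 < b -> mu.-integrable setT (fun x => (expR (- b * g x))%:E)) ->
  0 < beta ->
  let weight x := expR (- beta * (w x + g x)) in
  [/\ mu.-integrable setT (fun x => (weight x)%:E),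
      mu.-integrable setT (fun x => (w x * weight x)%:E) &
      mu.-integrable setT (fun x => (g x * weight x)%:E)].
Proof.
move=> mw mg wB g0 ig b0 weight.
have mweight : measurable_fun setT weight.
  apply: measurableT_comp => //; apply: measurable_funM => //.
  exact: measurable_funD.
have leW x : weight x <= expR (beta * B) * expR (- beta * g x).
  rewrite -expRD ler_expR mulrDr lerD2r mulNr -mulrN; apply: ler_wpM2l; first exact: ltW.
  by have := wB x; rewrite ler_norml => /andP[? _]; rewrite lerNl.
have iW : mu.-integrable setT (fun x => (weight x)%:E).
  have iE := integrableZl measurableT (expR (beta * B)) (ig beta b0).
  apply: le_integrable iE => //; first exact/measurable_EFinP.
  by move=> x _; rewrite -EFinM !abse_EFin lee_fin !ger0_norm ?mulr_ge0 ?expR_ge0.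
split => //.
- have iE := integrableZl measurableT B iW.
  apply: le_integrable iE => //.
    by apply/measurable_EFinP; exact: measurable_funM.
  move=> x _; rewrite -EFinM !abse_EFin lee_fin !normrM ler_wpM2r//.
  exact: le_trans (wB x) (ler_norm _).
- have b20 : 0 < beta / 2 by rewrite divr_gt0.
  have iE := integrableZl measurableT (expR (beta * B) * (beta / 2)^-1) (ig _ b20).
  apply: le_integrable iE => //.
    by apply/measurable_EFinP; exact: measurable_funM.
  move=> x _; rewrite -EFinM !abse_EFin lee_fin.
  rewrite !ger0_norm ?mulr_ge0 ?expR_ge0 ?invr_ge0 ?(ltW b20)//.
  apply: le_trans (ler_wpM2l (g0 x) (leW x)) _.
  (* This is [s <= 1 + s <= expR s] at [s = beta / 2 * g x]. *)
  have gE : g x * expR (- (beta / 2) * g x) <= (beta / 2)^-1.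
    rewrite mulNr expRN ler_pdivrMr ?expR_gt0// -ler_pdivrMl ?invr_gt0// invrK.
    by apply: le_trans (expR_ge1Dx _); rewrite lerDr.
  have -> : - beta * g x = - (beta / 2) * g x + - (beta / 2) * g x by lra.
  rewrite expRD mulrCA -!mulrA ler_pM2l ?expR_gt0// !mulrA ler_pM2r ?expR_gt0//.
Qed.

(** The exponential inequality is integrated against the unnormalized [weight], so every term
    carries a factor [Z] in place of a division. *)
Lemma gibbs_free_energy_le d (T : measurableType d) (R : realType)
    (mu : {measure set T -> \bar R}) (w g : T -> R) (beta m a : R) :
  let weight x := expR (- beta * (w x + g x)) in
  let Z := (\int[mu]_x weight x)%R in
  mu.-integrable setT (fun x => (weight x)%:E) ->
  mu.-integrable setT (fun x => (w x * weight x)%:E) ->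
  mu.-integrable setT (fun x => (g x * weight x)%:E) ->
  mu.-integrable setT (fun x => (expR (- g x))%:E) ->
  expR (- a - beta * m) * (\int[mu]_x expR (- g x))%R <= Z ->
  beta * (\int[mu]_x (w x * weight x))%R + (beta - 1) * (\int[mu]_x (g x * weight x))%R
    - beta * m * Z <= a * Z.
Proof.
move=> weight Z iW iwW igW igE leZ.
have : beta * (\int[mu]_x (w x * weight x))%R + (beta - 1) * (\int[mu]_x (g x * weight x))%R
    <= expR (- a - beta * m) * (\int[mu]_x expR (- g x))%R + (a - 1 + beta * m) * Z.
  have iM k (f : T -> R) : mu.-integrable setT (EFin \o f) ->
      mu.-integrable setT (EFin \o (fun x => k * f x)).
    exact: integrableZl.
  have iD (f h : T -> R) : mu.-integrable setT (EFin \o f) -> mu.-integrable setT (EFin \o h) ->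
      mu.-integrable setT (EFin \o (fun x => f x + h x)).
    exact: integrableD.
  rewrite /Z -!RintegralZl//.
  rewrite -(RintegralD measurableT (iM _ _ iwW) (iM _ _ igW)).
  rewrite -(RintegralD measurableT (iM _ _ igE) (iM _ _ iW)).
  apply: le_Rintegral => //.
  - exact: (iD _ _ (iM _ _ iwW) (iM _ _ igW)).
  - exact: (iD _ _ (iM _ _ igE) (iM _ _ iW)).
  move=> x _.
  pose u := beta * (w x + g x - m) - g x.
  (* The exponent of [weight] cancels [beta * (w x + g x)] in [u], leaving a multiple of
     [expR (- g x)], which [leZ] controls. *)
  have uE : expR (u - a) * weight x = expR (- a - beta * m) * expR (- g x).
    by rewrite /weight -!expRD /u; congr expR; ring.
  have := ler_wpM2r (expR_ge0 (- beta * (w x + g x))) (expR_ge1Dx (u - a)).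
  by rewrite -/(weight x) uE /u; lra.
by lra.
Qed.

(** Integrals see [eta] only up to null sets, so those against [eta] are those against [weight],
    divided by [Z]; the test function 1 gives total mass one. *)
Lemma density_of_gibbs d (T : measurableType d) (R : realType)
    (mu : {measure set T -> \bar R}) (weight eta : T -> R) :
  let Z := (\int[mu]_x weight x)%R in
  mu.-integrable setT (fun x => (weight x)%:E) -> 0 < Z ->
  measurable_fun setT eta -> (forall x, 0 <= eta x) ->
  (\forall x \ae mu, eta x = weight x / Z) ->
  density mu eta /\
  forall f : T -> R, measurable_fun setT f -> mu.-integrable setT (fun x => (f x * weight x)%:E) ->
    mu.-integrable setT (fun x => (f x * eta x)%:E) /\
    (\int[mu]_x (f x * eta x))%R = (\int[mu]_x (f x * weight x))%R / Z.
Proof.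
move=> Z iW Z0 meta eta0 etaE.
have mW : measurable_fun setT weight by apply/measurable_EFinP; exact: measurable_int iW.
have key (f : T -> R) : measurable_fun setT f ->
    mu.-integrable setT (fun x => (f x * weight x)%:E) ->
    mu.-integrable setT (fun x => (f x * eta x)%:E) /\
    (\int[mu]_x (f x * eta x))%R = (\int[mu]_x (f x * weight x))%R / Z.
  move=> mf ifW.
  have iZ : mu.-integrable setT (fun x => (Z^-1 * (f x * weight x))%:E).
    by have := integrableZl measurableT Z^-1 ifW.
  have ae : ae_eq mu setT (fun x => (Z^-1 * (f x * weight x))%:E) (fun x => (f x * eta x)%:E).
    apply: filterS etaE => x -> _; congr (_%:E); ring.
  have mfe : measurable_fun setT (fun x => (f x * eta x)%:E).
    by apply/measurable_EFinP; exact: measurable_funM.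
  have int1 : (\int[mu]_x `|(f x * eta x)%:E| = \int[mu]_x `|(Z^-1 * (f x * weight x))%:E|)%E.
    apply: ae_eq_integral => //.
    - by apply: measurableT_comp => //; exact: mfe.
    - by apply: measurableT_comp => //; exact: measurable_int iZ.
    - exact: (ae_eq_sym (ae_eq_abse ae)).
  split.
    apply/integrableP; split => //; rewrite int1.
    by have /integrableP[] := iZ.
  rewrite mulrC -RintegralZl// /Rintegral; congr fine.
  by apply: ae_eq_integral => //; [exact: measurable_int iZ|exact: ae_eq_sym].
split=> //; split => //.
have [|i1 E1] := key (fun=> 1) (measurable_cst _).
  by under eq_fun do rewrite mul1r.
move: E1 i1; under eq_Rintegral do rewrite mul1r.
under [X in X / Z]eq_Rintegral do rewrite mul1r.
rewrite divff ?gt_eqF// => E1 i1.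
have ie : mu.-integrable setT (fun x => (eta x)%:E).
  by apply: eq_integrable i1 => // x _; rewrite mul1r.
rewrite -(fineK (integrable_fin_num measurableT ie)).
by rewrite [fine _]E1.
Qed.

(** A zero integral would make [expR (V x)] vanish almost everywhere, hence be at most 0 everywhere
    by continuity. *)
Lemma Rintegral_expR_gt0 (R : realType) n (V : 'rV[R]_n -> R) :
  continuous V -> (lebesgue_rV n).-integrable setT (fun x => (expR (V x))%:E) ->
  0 < (\int[lebesgue_rV n]_x expR (V x))%R.
Proof.
move=> cV iV; rewrite lt_neqAle Rintegral_ge0 ?andbT => [|x _]; last exact: expR_ge0.
apply/negP => /eqP int0.
have int0' : (\int[lebesgue_rV n]_x `|(expR (V x))%:E| = 0)%E.
  under eq_integral do rewrite abse_EFin ger0_norm ?expR_ge0//.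
  rewrite -(fineK (integrable_fin_num measurableT iV)).
  exact: (congr1 EFin (esym int0)).
have /(ae_eq_integral_abs _ measurableT (measurable_int _ iV)).1 ae0 := int0'.
have cW : continuous (fun x => expR (V x)).
  move=> x; have cE : {for V x, continuous (@expR R)} by exact: continuous_expR.
  exact: (continuous_comp (cV x) cE).
have : expR (V 0) <= 0.
  apply: ae_lebesgue_rV_le (fun x => expR (V x)) 0 cW _ 0.
  by apply: filterS ae0 => x /(_ I) [->].
by rewrite leNgt expR_gt0.
Qed.

(** * Lower bounds for the functional by linearization *)

Lemma normr_coord_le_enorm (R : realType) d (u : 'rV[R]_d) i : `|u ord0 i| <= enorm u.
Proof.
rewrite -sqrtr_sqr; apply: ler_wsqrtr; rewrite /sqnorm /dotp (bigD1 i)//= -expr2 lerDl.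
by apply: sumr_ge0 => j _; rewrite -expr2 sqr_ge0.
Qed.

Lemma density_L1_unit_ball d (T : measurableType d) (R : realType)
    (mu : {measure set T -> \bar R}) (nu : T -> R) :
  density mu nu -> L1_unit_ball mu nu.
Proof.
move=> [mnu nu0 nu1]; have le1 : (\int[mu]_x `|nu x|%:E <= 1)%E.
  by under eq_integral do rewrite ger0_norm//; rewrite nu1.
split=> //; apply/integrableP; split; first exact/measurable_EFinP.
exact: le_lt_trans le1 (ltry 1).
Qed.

Lemma integrable_bounded_density d (T : measurableType d) (R : realType)
    (mu : {measure set T -> \bar R}) (nu w : T -> R) (B : R) :
  density mu nu -> measurable_fun setT w -> (forall x, `|w x| <= B) ->
  mu.-integrable setT (fun x => (w x * nu x)%:E).
Proof.
move=> dnu mw wB; have [mnu nu0 _] := dnu.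
have [inu _] := density_L1_unit_ball dnu.
have iE := integrableZl measurableT B inu.
apply: le_integrable iE => //; first by apply/measurable_EFinP; exact: measurable_funM.
move=> x _; rewrite -EFinM !abse_EFin lee_fin !normrM ler_wpM2r//.
exact: le_trans (wB x) (ler_norm _).
Qed.

(** The inner products that determine a mean turn both integrals into pairings with [dR], and the
    claim becomes the tangent inequality for [Rf] at the mean of [eta]. *)
Lemma F0_ge_linearization (R : realType) d (H : completeNormedModType R) (ip : H -> H -> R)
    (Rf : H -> R) (dR : H -> H) (Psi : 'rV[R]_d -> H) (eta nu : 'rV[R]_d -> R) :
  mean_defined ip Psi -> convex_function [set: convex_lmodType H] Rf ->
  is_gradient ip Rf dR ->
  L1_unit_ball (lebesgue_rV d) eta -> L1_unit_ball (lebesgue_rV d) nu ->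
  F0 ip Rf Psi eta
    + (\int[lebesgue_rV d]_th (dF0 ip dR Psi eta th * nu th))%R
    - (\int[lebesgue_rV d]_th (dF0 ip dR Psi eta th * eta th))%R <= F0 ip Rf Psi nu.
Proof.
move=> dmean cRf grad beta bnu.
have meanP rho : L1_unit_ball (lebesgue_rV d) rho -> is_mean ip Psi rho (mean ip Psi rho).
  by move=> /dmean ex; exact: xgetPex ex.
have [_ Eeta] := meanP _ beta; have [_ Enu] := meanP _ bnu.
rewrite /dF0 -Eeta -Enu /F0.
set x := mean ip Psi eta; set y := mean ip Psi nu.
have [dRf dE] := grad x.
have := convex_gradient_le y cRf dRf.
by rewrite raddfB/= !dE addrA.
Qed.

(** After linearization only the integral of [dF] at [eta] against [nu] remains; it is at least [m]
    because [nu] has mass one. *)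
Lemma F1_ge (R : realType) d (H : completeNormedModType R) (ip : H -> H -> R)
    (Rf : H -> R) (dR : H -> H) (Psi : 'rV[R]_d -> H) (g : 'rV[R]_d -> R)
    (eta nu : 'rV[R]_d -> R) (m B : R) :
  mean_defined ip Psi -> convex_function [set: convex_lmodType H] Rf ->
  is_gradient ip Rf dR ->
  measurable_fun setT (dF0 ip dR Psi eta) -> measurable_fun setT g ->
  (forall th, `|dF0 ip dR Psi eta th| <= B) -> (forall th, 0 <= g th) ->
  (forall th, m <= dF ip dR Psi g eta th) ->
  L1_unit_ball (lebesgue_rV d) eta -> density (lebesgue_rV d) nu ->
  ((F0 ip Rf Psi eta + m
    - (\int[lebesgue_rV d]_th (dF0 ip dR Psi eta th * eta th))%R)%:E <= F ip Rf Psi g 1 nu)%E.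
Proof.
move=> dmean cRf grad mw mg wB g0 mV beta dnu; have [mnu nu0 nu1] := dnu.
have bnu := density_L1_unit_ball dnu; have [inu _] := bnu.
have lin := F0_ge_linearization dmean cRf grad beta bnu.
have iw := integrable_bounded_density dnu mw wB.
have Gge0 : (0 <= \int[lebesgue_rV d]_th (g th * nu th)%:E)%E.
  by apply: integral_ge0 => th _; rewrite lee_fin mulr_ge0.
rewrite /F mul1e.
(* If the integral of [g] against [nu] is infinite the bound is trivial; otherwise all terms are
   real. *)
have [Goo|Gfin] := eqVneq (\int[lebesgue_rV d]_th (g th * nu th)%:E)%E +oo%E.
  by rewrite Goo addey ?leey.
have ig : (lebesgue_rV d).-integrable setT (fun th => (g th * nu th)%:E).
  apply/integrableP; split; first by apply/measurable_EFinP; exact: measurable_funM.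
  under eq_integral do rewrite abse_EFin ger0_norm ?mulr_ge0//.
  by rewrite ltey.
rewrite -(fineK (integrable_fin_num measurableT ig)) -EFinD lee_fin.
have : m <= (\int[lebesgue_rV d]_th (dF0 ip dR Psi eta th * nu th))%R
           + (\int[lebesgue_rV d]_th (g th * nu th))%R.
  rewrite -(RintegralD measurableT iw ig).
  have -> : m = (\int[lebesgue_rV d]_th (m * nu th))%R.
    by rewrite RintegralZl// /Rintegral nu1 mulr1.
  apply: le_Rintegral => //; first exact: (integrableZl measurableT m inu).
    exact: (integrableD measurableT iw ig).
  by move=> th _; rewrite -mulrDl ler_wpM2r//; exact: mV.
rewrite /Rintegral in lin *; lra.
Qed.

Theorem theorem4 (R : realType) (d : nat)
    (H : completeNormedModType R) (ip : H -> H -> R)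
    (Rf : H -> R) (dR : H -> H) (Psi : 'rV[R]_d -> H) (g : 'rV[R]_d -> R)
    (Hip : is_inner_product ip)
    (Rf_ge0 : forall m, 0 <= Rf m)
    (g_ge0 : forall th, 0 <= g th)
    (Hmean : mean_defined ip Psi)
    (A1_convex : convex_function [set: convex_lmodType H] Rf)
    (A1_diff : is_gradient ip Rf dR)
    (A2 : forall th, differentiable Psi th)
    (A3 : bounded_gradients ip dR Psi g)
    (A4_equicontinuous : uniformly_equicontinuous_dF0 ip dR Psi)
    (A4_bounded : uniformly_bounded_dF0 ip dR Psi)
    (A4_g_diff : forall th, differentiable g th)
    (A4_g_confining : confining g)
    (Hstationary : stationary_solutions_are_gibbs ip dR Psi g) :
  exists C : R, forall gamma beta : R, 0 < gamma -> 1 <= beta ->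
    forall rhos : 'rV[R]_d * 'rV[R]_d -> R,
      is_stationary ip dR Psi g gamma beta rhos ->
      (F ip Rf Psi g (1 - 1 / beta) (marginal rhos) <=
       ereal_inf [set F ip Rf Psi g 1 nu | nu in density (@lebesgue_rV R d)] +
       ((C + d%:R * ln beta) / beta)%:E)%E.
Proof.
have [L AL] := A3; have [B AB] := A4_bounded; have [_ ig] := A4_g_confining.
have cg : continuous g by move=> x; apply: differentiable_continuous.
have mg := continuous_rV_measurable cg.
have igE : (lebesgue_rV d).-integrable setT (fun x => (expR (- g x))%:E).
  by apply: eq_integrable (ig 1 ltr01) => // x _; rewrite mulN1r.
have cNg : continuous (fun x => - g x) by move=> x; exact: (continuousN (cg x)).
have I0 := Rintegral_expR_gt0 cNg igE.
(* The logarithm compares the partition function with the integral of [expR (- g x)], the 1 pays for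
   an approximate minimizer of [V], and the last term for the variation of [V] on the cube. *)
exists (ln (\int[lebesgue_rV d]_x expR (- g x))%R + 1 + `|L| * d%:R).
move=> gamma beta gamma0 beta1 rhos st.
have beta0 : 0 < beta by exact: lt_le_trans ltr01 beta1.
have [drho _ _] := st; have [_ etaE] := Hstationary _ _ gamma0 beta0 _ st.
set eta := marginal rhos in etaE *.
have etaL1 : L1_unit_ball (lebesgue_rV d) eta := marginal_L1_unit_ball drho.
pose w := dF0 ip dR Psi eta.
have dw := differentiable_dF0 A1_diff A2 eta.
have cw : continuous w by move=> x; apply: differentiable_continuous; exact: dw.
have mw := continuous_rV_measurable cw.
have wB x : `|w x| <= B := AB _ etaL1 x.
pose V := dF ip dR Psi g eta.
have dV x : differentiable V x by apply: differentiableD; [exact: dw|exact: A4_g_diff].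
have cV : continuous V by move=> x; apply: differentiable_continuous.
have [iW iwW igW] := integrable_gibbs mw mg wB g_ge0 ig beta0.
have cbV : continuous (fun x => - beta * V x).
  move=> x; have cM : {for V x, continuous ( *%R (- beta))} by exact: mulrl_continuous.
  exact: (continuous_comp (cV x) cM).
have Z0 := Rintegral_expR_gt0 cbV iW.
have [deta etaI] := density_of_gibbs iW Z0 (measurable_marginal drho) (marginal_ge0 drho) etaE.
(* [AL] applies since [deta] makes [eta] a true density; its constant depends neither on [beta] nor
   on [rhos]. *)
have lipV x y : `|V y - V x| <= `|L| * \sum_(i < d) `|y ord0 i - x ord0 i|.
  apply: lipschitz_of_ae_gradient_le => //.
    by move=> z i; exact: diff_derivable.
  apply: filterS (AL _ deta) => z Lz i; apply: le_trans (ler_norm _).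
  apply: le_trans Lz; have := normr_coord_le_enorm (nabla V z) i.
  by rewrite mxE.
have VB x : - B <= V x.
  have := wB x; rewrite ler_norml => /andP[Bw _].
  by apply: le_trans Bw _; rewrite lerDl.
pose m := inf (range V).
have infV : has_inf (range V).
  by split; [exists (V 0), 0|exists (- B) => _ [x _ <-]].
have mV x : m <= V x by apply: ge_inf; [case: infV|exists x].
(* A point within [beta^-1] of the infimum replaces a minimizer, at the cost of a factor
   [expR (- 1)] in the partition function. *)
have [th thV] : exists th, V th < m + beta^-1.
  have [|_ [th _ <-] thm] := @inf_adherent _ (range V) beta^-1 _ infV.
    by rewrite invr_gt0.
  by exists th.
set I := (\int[lebesgue_rV d]_x expR (- g x))%R in I0 *.
set a := ln I + 1 + `|L| * d%:R + d%:R * ln beta.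
have Zge : expR (- a - beta * m) * I <= (\int[lebesgue_rV d]_x expR (- beta * V x))%R.
  rewrite -lee_fin [leRHS]fineK; last exact: integrable_fin_num iW.
  have mV' := continuous_rV_measurable cV.
  apply: le_trans (partition_function_ge mV' (normr_ge0 L) beta0 (lipV th)).
  rewrite lee_fin.
  (* The two logarithms in [a] cancel [I] and produce [beta^-1 ^+ d]. *)
  have -> : expR (- a - beta * m) * I
      = expR (- beta * m - 1 - `|L| * d%:R) * beta^-1 ^+ d.
    rewrite -[in LHS](lnK I0) -[beta^-1](lnK (_ : beta^-1 \is Num.pos)) ?posrE ?invr_gt0//.
    rewrite -expRM_natl -!expRD lnV ?posrE//; congr expR; rewrite /a; ring.
  rewrite ler_pM2r ?exprn_gt0 ?invr_gt0// ler_expR lerD2r.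
  have bb : beta * beta^-1 = 1 by rewrite divff ?gt_eqF.
  by have := ler_wpM2l (ltW beta0) (ltW thV); rewrite [X in _ <= X]mulrDr bb; lra.
have := gibbs_free_energy_le iW iwW igW igE Zge.
(* Dividing by the partition function turns the integrals against the weight into integrals against
   [eta]. *)
rewrite -ler_pdivrMr// mulrBl mulrDl -!mulrA divff ?gt_eqF//.
have [_ <-] := etaI _ mw iwW; have [igeta <-] := etaI _ mg igW.
set A := (\int[_]_x (w x * _))%R; set G := (\int[_]_x (g x * _))%R.
rewrite mulr1 => AG.
have GE : (\int[lebesgue_rV d]_x (g x * eta x)%:E)%E = G%:E.
  by rewrite -(fineK (integrable_fin_num measurableT igeta)).
rewrite /F GE -EFinM -EFinD -leeBlDr// -EFinB.
apply: le_ereal_inf_tmp => _ [nu dnu <-].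
apply: le_trans (F1_ge Hmean A1_convex A1_diff mw mg wB g_ge0 mV etaL1 dnu).
rewrite lee_fin -/a -/A.
(* Dividing [AG] by [beta] turns the coefficient [beta - 1] of [G] into [1 - 1 / beta], the weight
   of [g] in the claim. *)
have : A + (1 - 1 / beta) * G - m <= a / beta.
  rewrite ler_pdivlMr//; apply: le_trans AG; rewrite le_eqVlt; apply/orP; left.
  by apply/eqP; field; rewrite gt_eqF.
lra.
Qed.
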